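(* Let $f\in\mathrm{LC}$ satisfy (H$_1$), (H$_3$) and (H$_2^*$) there are $\alpha_1>0$ and $K\ge1$ with $\exp\big(\int_s^t\alpha(u)du\big)\le Ke^{-\alpha_1(t-s)}$ for $0\le s\le t$. Then for every $\tau\in\mathbb R$ the solutions of $\dot x=f(t,x)$ are uniformly ultimately bounded on $[\tau,\infty)$.
   Context: $\mathrm{LC}$: Borel measurable $f:\mathbb R\times\mathbb R^N\to\mathbb R^N$ such that for every compact $K$ there are $m^K,l^K\in L^1_{loc}$ with $|f(t,x)|\le m^K(t)$ and $|f(t,x)-f(t,y)|\le l^K(t)|x-y|$ for $x,y\in K$, a.e. $t$. (H$_1$): there exist $\alpha,\beta\in L^1_{loc}$ with $\beta\ge0$ such that $2\langle f(t,x),x\rangle\le\alpha(t)|x|^2+\beta(t)$ for a.e. $(t,x)\in\mathbb R^{1+N}$. (H$_3$): $\sup_{t\in\mathbb R}\int_{-r}^r\beta(s+t)ds<\infty$ for every $r>0$. Under (H$_1$) solutions of $\dot x=f(t,x)$, $x(r)=x_0$ exist on $[r,\infty)$; $S_f(t,r)x_0$ denotes their value at $t\ge r$. The solutions are uniformly ultimately bounded on $[\tau,\infty)$ if there is $c(\tau)>0$ such that for every $d>0$ there is $T(\tau,d)>0$ with $|S_f(t+r,r)x_0|\le c(\tau)$ whenever $r\ge\tau$, $t\ge T(\tau,d)$, $|x_0|\le d$. *)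

(* Defs.v *)
From HB Require Import structures.
From mathcomp Require Import all_boot all_order all_algebra.
From mathcomp Require Import all_classical all_reals all_analysis.
Set Implicit Arguments. Unset Strict Implicit. Unset Printing Implicit Defensive.
Import Order.TTheory GRing.Theory Num.Theory.
Import numFieldNormedType.Exports.
Local Open Scope classical_set_scope.
Local Open Scope ring_scope.

(* R^N is represented by row vectors 'rV[R]_N (topology = product topology). *)
Section Defs.
Variables (R : realType) (N : nat).
Local Notation vec := 'rV[R]_N.

Definition dotv (x y : vec) : R := \sum_(i < N) x ord0 i * y ord0 i.
Definition enorm (x : vec) : R := Num.sqrt (dotv x x).

Definition borel_fun (g : R * vec -> R) : Prop :=
  forall B : set R, measurable B -> <<s open >> (g @^-1` B).

Definition borel_vfield (f : R -> vec -> vec) : Prop :=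
  forall i : 'I_N, borel_fun (fun p => f p.1 p.2 ord0 i).

Definition locint (g : R -> R) : Prop :=
  forall a b : R, lebesgue_measure.-integrable `[a, b] (EFin \o g).

(* Lebesgue-null sets of R^{1+N} = R x R^N: coverable by countably many
   closed boxes of arbitrarily small total volume. *)
Definition box (a b : R * vec) : set (R * vec) :=
  [set p : R * vec | (a.1 <= p.1 <= b.1) /\ forall i, a.2 ord0 i <= p.2 ord0 i <= b.2 ord0 i].
Definition boxvol (a b : R * vec) : R :=
  Num.max 0 (b.1 - a.1) * \prod_(i < N) Num.max 0 (b.2 ord0 i - a.2 ord0 i).
Definition null_set (E : set (R * vec)) : Prop :=
  forall eps : R, 0 < eps -> exists a b : nat -> R * vec,
    E `<=` \bigcup_k box (a k) (b k) /\
    forall n, \sum_(k < n) boxvol (a k) (b k) <= eps.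

Definition LC (f : R -> vec -> vec) : Prop :=
  borel_vfield f /\
  forall K : set vec, compact K -> exists m l : R -> R,
    locint m /\ locint l /\
    {ae lebesgue_measure, forall t, forall x y, K x -> K y ->
       enorm (f t x) <= m t /\ enorm (f t x - f t y) <= l t * enorm (x - y)}.

Definition H1 (f : R -> vec -> vec) (alpha beta : R -> R) : Prop :=
  locint alpha /\ locint beta /\ (forall t, 0 <= beta t) /\
  exists E, null_set E /\ forall t x, ~ E (t, x) ->
    2 * dotv (f t x) x <= alpha t * enorm x ^+ 2 + beta t.

Definition H3 (beta : R -> R) : Prop :=
  forall r : R, 0 < r -> exists C : R, forall t : R,
    Rintegral lebesgue_measure `[- r, r] (fun s => beta (s + t)) <= C.

Definition H2star (alpha : R -> R) : Prop :=
  exists alpha1 K : R, 0 < alpha1 /\ 1 <= K /\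
    forall s t : R, 0 <= s -> s <= t ->
      expR (Rintegral lebesgue_measure `[s, t] alpha)
        <= K * expR (- alpha1 * (t - s)).

Definition is_solution (f : R -> vec -> vec) (r : R) (x0 : vec)
    (x : R -> vec) : Prop :=
  x r = x0 /\
  forall t, r <= t -> forall i : 'I_N,
    lebesgue_measure.-integrable `[r, t] (fun s => (f s (x s) ord0 i)%:E) /\
    x t ord0 i = x0 ord0 i
                 + Rintegral lebesgue_measure `[r, t] (fun s => f s (x s) ord0 i).

Definition UUB (f : R -> vec -> vec) (tau : R) : Prop :=
  exists c : R, 0 < c /\
  forall d : R, 0 < d -> exists T : R, 0 < T /\
    forall (r t : R) (x0 : vec) (x : R -> vec),
      tau <= r -> T <= t -> enorm x0 <= d -> is_solution f r x0 x ->
      enorm (x (t + r)) <= c.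

End Defs.

(* Main.v *)
(* Along a solution x, u = |x|^2 is absolutely continuous with derivative
   2 <f(t, x), x>, which (H1) bounds by alpha u + beta. Gronwall's inequality
   then gives
     |x(t)|^2 <= exp(int_r^t alpha) |x0|^2 + int_r^t exp(int_s^t alpha) beta(s) ds.
   (H2* ) extends to [tau, oo) at the price of a larger K. It makes the first
   term decay exponentially and bounds the second one by K times the convolution
   of beta with exp(-k t), which by (H3) is at most a geometric series over unit
   windows, whatever the initial value.

   (H1) is only assumed off a null set of R^{1+N}, which may contain the graph
   of x: by a Fubini argument almost every time slice of the null set has dense
   complement, and the continuity of f(t, .) extends the inequality to all x.

   Absolutely continuous functions are represented as indefinite integrals. The
   chain rule for phi o F, F' = f, holds because the increments over short
   intervals of phi o F and of the integral of phi'(F) f differ by an arbitrarily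
   small multiple of the integral of |f|. *)
Require Import Defs.
From mathcomp Require Import all_boot all_order all_algebra.
From mathcomp Require Import all_classical all_reals all_analysis.
From mathcomp Require Import measurable_realfun ring lra.
Import Order.TTheory GRing.Theory Num.Theory.
Import numFieldNormedType.Exports.
Set Implicit Arguments. Unset Strict Implicit. Unset Printing Implicit Defensive.
Local Open Scope classical_set_scope.
Local Open Scope ring_scope.

Section RealIntegrals.
Context d (T : measurableType d) (R : realType).
Variables (mu : {measure set T -> \bar R}) (D : set T) (mD : measurable D).
Implicit Types f g : T -> R.

Lemma integrable_EFinD f g :
  mu.-integrable D (EFin \o f) -> mu.-integrable D (EFin \o g) ->
  mu.-integrable D (EFin \o (fun x => f x + g x)).
Proof. by move=> intf intg; exact: (integrableD mD intf intg). Qed.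

Lemma integrable_EFinZ (k : R) f :
  mu.-integrable D (EFin \o f) -> mu.-integrable D (EFin \o (fun x => k * f x)).
Proof. by move=> intf; exact: (integrableZl mD k intf). Qed.

Lemma ae_le_Rintegral f g :
  mu.-integrable D (EFin \o f) -> mu.-integrable D (EFin \o g) ->
  {ae mu, forall x, D x -> f x <= g x} ->
  \int[mu]_(x in D) f x <= \int[mu]_(x in D) g x.
Proof.
move=> intf intg fg; rewrite -subr_ge0 -RintegralB//.
have intgf : mu.-integrable D (EFin \o (fun x => g x - f x)).
  exact: (integrableB mD intg intf).
suff -> : \int[mu]_(x in D) (g x - f x) = \int[mu]_(x in D) `|g x - f x|.
  exact: Rintegral_ge0.
congr fine; apply: ae_eq_integral => //.
- exact: (measurable_int mu).
- exact: (measurable_int mu (integrable_norm intgf)).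
- apply: filterS fg => x fgx Dx.
  by rewrite ger0_norm// subr_ge0 fgx.
Qed.

End RealIntegrals.

(* Resolution does not find the library's instance at the display of
   [lebesgue_measure]. *)
#[local] Instance ae_lebesgue_filter (R : realType) :
  Filter (nbhs (almost_everywhere (@lebesgue_measure R))).
Proof. exact: ae_filter_ringOfSetsType. Qed.

Section IntervalIntegrals.
Context {R : realType}.
Local Notation mu := (@lebesgue_measure R).
Implicit Types (f g : R -> R) (a b s t : R).

Lemma integrable_sub_itv f a b s t : a <= s -> t <= b ->
  mu.-integrable `[a, b] (EFin \o f) -> mu.-integrable `[s, t] (EFin \o f).
Proof.
by move=> le_as tb; apply: integrableS => //; apply: subset_itv; rewrite bnd_simp.
Qed.

Lemma integrable_continuousM f g a b :
  {within `[a, b], continuous g} -> mu.-integrable `[a, b] (EFin \o f) ->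
  mu.-integrable `[a, b] (EFin \o (fun x => g x * f x)).
Proof.
move=> cg intf; apply: (@integrableMr _ _ _ mu) intf => //.
  exact: subspace_continuous_measurable_fun.
have [M [_ gM]] := compact_bounded (continuous_compact cg (@segment_compact _ a b)).
by exists M; split; rewrite ?num_real// => M' MM' x abx; apply: gM => //; exists x.
Qed.

Lemma Rintegral_itv_split f a s t : a <= s -> s <= t ->
  mu.-integrable `[a, t] (EFin \o f) ->
  \int[mu]_(w in `[a, t]) f w =
  \int[mu]_(w in `[a, s]) f w + \int[mu]_(w in `[s, t]) f w.
Proof.
move=> le_as st intf.
have -> : \int[mu]_(w in `[s, t]) f w = \int[mu]_(w in `]s, t]) f w.
  rewrite Rintegral_itv_obnd_cbnd//.
  by apply: integrableS intf => //; apply: subset_itv; rewrite bnd_simp.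
by rewrite -(@Rintegral_itvB _ f (BLeft a) (BRight t) s)// addrCA subrr addr0.
Qed.

Lemma ge0_le_Rintegral_itv f a b s t :
  mu.-integrable `[a, b] (EFin \o f) -> (forall w, 0 <= f w) ->
  a <= s -> s <= t -> t <= b ->
  \int[mu]_(w in `[s, t]) f w <= \int[mu]_(w in `[a, b]) f w.
Proof.
move=> intf f0 le_as st tb.
rewrite (@Rintegral_itv_split _ a s b) ?(le_trans st tb)//.
rewrite (@Rintegral_itv_split _ s t b)//; last exact: integrable_sub_itv intf.
rewrite addrCA lerDl addr_ge0//; exact: Rintegral_ge0.
Qed.

End IntervalIntegrals.

Section Translation.
Context {R : realType}.
Local Notation mu := (@lebesgue_measure R).

Lemma preimage_addr_itv (c : R) (b1 b2 : bool) (a b : R) :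
  (fun s => s + c) @^-1` [set` Interval (BSide b1 a) (BSide b2 b)] =
  [set` Interval (BSide b1 (a - c)) (BSide b2 (b - c))].
Proof.
by apply/seteqP; split=> s /=; rewrite !itv_boundlr /=;
  case: b1 b2 => -[]; rewrite !bnd_simp ?lerBlDr ?ltrBlDr ?lerBrDr ?ltrBrDr.
Qed.

Lemma lebesgue_measure_translate (c : R) (A : set R) : measurable A ->
  pushforward mu ((fun s => s + c) : _ -> measurableTypeR R) A = mu A.
Proof.
move=> mA; apply/esym/lebesgue_measure_unique => //=.
  exact: measurable_funD.
move=> mphi _ [[a b]] _ <-.
rewrite /pushforward preimage_addr_itv !lebesgue_measure_itv/= !lte_fin ltrD2r.
by case: ifP => // _; rewrite -!EFinB; congr EFin; ring.
Qed.

Lemma ge0_Rintegral_translate (g : R -> R) (a b c : R) :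
  mu.-integrable `[a, b] (EFin \o g) -> (forall t, 0 <= g t) ->
  \int[mu]_(s in `[a - c, b - c]) g (s + c) = \int[mu]_(s in `[a, b]) g s.
Proof.
move=> intg g0; rewrite /Rintegral; congr fine.
rewrite -[X in integral _ X _](@preimage_addr_itv c true false a b).
pose phi : measurableTypeR R -> measurableTypeR R := fun s => s + c.
have mphi : measurable_fun setT phi by exact: measurable_funD.
rewrite -(ge0_integral_pushforward mphi mu (D := `[a, b]%classic)
  (f := fun y => (g y)%:E))//.
- by apply: eq_measure_integral => //= A mA _; exact: lebesgue_measure_translate.
- exact: (measurable_int mu).
- by move=> y _; rewrite lee_fin.
Qed.

End Translation.

Section LocalToGlobal.
Context {R : realType}.
Implicit Types (H M : R -> R) (a b : R).

Lemma locally_nonincreasing_le H a b : a <= b ->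
  (forall c, a <= c <= b -> exists2 e, 0 < e & forall s t,
     a <= s <= c -> c <= t <= b -> c - e < s -> t < c + e -> H t <= H s) ->
  H b <= H a.
Proof.
move=> ab loc; pose S := [set t | a <= t <= b /\ H t <= H a].
have Sa : S a by rewrite /S /= lexx ab.
have supS : has_sup S by split; [exists a|exists b => t [/andP[]]].
pose c := sup S.
have /andP[ac cb] : a <= c <= b.
  rewrite (ub_le_sup supS.2 Sa)/=.
  by apply: ge_sup; [exists a|move=> t [/andP[]]].
have [e e0 Hc] := loc c (introT andP (conj ac cb)).
have [s [/andP[le_as sb] Hs] cs] := sup_adherent e0 supS.
have sc : s <= c by apply: (ub_le_sup supS.2); split => //; rewrite le_as.
have Hca : H c <= H a.
  by apply: le_trans Hs; apply: Hc; rewrite ?le_as ?lexx// ltrDl.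
move: cb; rewrite le_eqVlt => /predU1P[<-//|cb].
pose t := Num.min b (c + e / 2).
have ct : c < t by rewrite lt_min cb ltrDl divr_gt0.
suff St : S t by have := ub_le_sup supS.2 St; rewrite leNgt ct.
have tb : t <= b by rewrite ge_min lexx.
split; first by rewrite tb (le_trans ac (ltW ct)).
apply: le_trans Hca; apply: Hc; rewrite ?ac ?lexx ?tb ?(ltW ct)//.
  by rewrite ltrBlDr ltrDl.
by rewrite gt_min; apply/orP; right; lra.
Qed.

Definition locally_negligible_increment H M a b := forall c e,
  a <= c <= b -> 0 < e -> exists2 d, 0 < d & forall s t,
    a <= s <= c -> c <= t <= b -> c - d < s -> t < c + d ->
    `|H t - H s| <= e * (M t - M s).

Lemma locally_negligible_increment_le H M a b : a <= b ->
  locally_negligible_increment H M a b -> H b <= H a.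
Proof.
move=> ab small; apply/ler_addgt0Pr => e e0.
pose k := `|M b - M a| + 1.
have k0 : 0 < k by rewrite ltr_wpDl.
pose G t := H t - e / k * M t.
have : G b <= G a.
  apply: locally_nonincreasing_le => // c acb.
  have [d d0 small_d] := small c (e / k) acb (divr_gt0 e0 k0).
  exists d => // s t sc ct cs tc.
  have := le_trans (ler_norm _) (small_d s t sc ct cs tc).
  by rewrite /G mulrBr; lra.
have : e / k * (M b - M a) <= e.
  rewrite mulrAC ler_pdivrMr// ler_wpM2l ?(ltW e0)//.
  by rewrite (le_trans (ler_norm _))// lerDl.
by rewrite /G mulrBr; lra.
Qed.

Lemma locally_negligible_increment_eq H M a b : a <= b ->
  locally_negligible_increment H M a b -> H b = H a.
Proof.
move=> ab small; apply/eqP; rewrite eq_le.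
rewrite (locally_negligible_increment_le ab small) -lerN2.
rewrite (@locally_negligible_increment_le (fun t => - H t) M)// => c e acb e0.
have [d d0 small_d] := small c e acb e0; exists d => // s t sc ct cs tc.
by rewrite -opprD normrN small_d.
Qed.

End LocalToGlobal.

Section Primitives.
Context {R : realType}.
Local Notation mu := (@lebesgue_measure R).
Implicit Types (F G f g phi : R -> R) (a b s t : R).

(* F is absolutely continuous on [a, b] with almost everywhere derivative f. *)
Definition is_primitive a b F f :=
  mu.-integrable `[a, b] (EFin \o f) /\
  forall t, a <= t <= b -> F t = F a + \int[mu]_(w in `[a, t]) f w.

Lemma is_primitive_increment a b F f s t : is_primitive a b F f ->
  a <= s -> s <= t -> t <= b -> F t - F s = \int[mu]_(w in `[s, t]) f w.
Proof.
move=> [intf FE] le_as st tb.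
rewrite (FE t) ?(le_trans le_as st)// (FE s) ?le_as ?(le_trans st tb)//.
rewrite (Rintegral_itv_split le_as st); last exact: integrable_sub_itv intf.
by ring.
Qed.

Lemma is_primitive_subitv a b s t F f : a <= s -> t <= b ->
  is_primitive a b F f -> is_primitive s t F f.
Proof.
move=> le_as tb prF; split; first exact: integrable_sub_itv prF.1.
move=> w /andP[sw wt].
rewrite -(is_primitive_increment prF le_as sw (le_trans wt tb)).
by rewrite addrC subrK.
Qed.

Lemma is_primitive_Rintegral f a b : mu.-integrable `[a, b] (EFin \o f) ->
  is_primitive a b (fun t => \int[mu]_(w in `[a, t]) f w) f.
Proof. by move=> intf; split=> // t _; rewrite set_itv1 Rintegral_set1 add0r. Qed.

Lemma is_primitive_cst a b c : is_primitive a b (fun=> c) (fun=> 0).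
Proof.
split=> [|t _]; last by rewrite /Rintegral integral0 addr0.
exact: integrable0.
Qed.

Lemma is_primitiveD a b F G f g : is_primitive a b F f -> is_primitive a b G g ->
  is_primitive a b (fun t => F t + G t) (fun t => f t + g t).
Proof.
move=> [intf FE] [intg GE]; split; first exact: integrable_EFinD.
move=> t abt; rewrite (FE t abt) (GE t abt); have /andP[_ tb] := abt.
rewrite RintegralD//; last 2 first.
- exact: integrable_sub_itv (lexx a) tb intf.
- exact: integrable_sub_itv (lexx a) tb intg.
by rewrite addrACA.
Qed.

Lemma is_primitiveZ a b k F f : is_primitive a b F f ->
  is_primitive a b (fun t => k * F t) (fun t => k * f t).
Proof.
move=> [intf FE]; split; first exact: integrable_EFinZ.
move=> t abt; rewrite (FE t abt); have /andP[_ tb] := abt.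
by rewrite mulrDr RintegralZl//; exact: integrable_sub_itv (lexx a) tb intf.
Qed.

Lemma is_primitive_sum n a b (F f : 'I_n -> R -> R) :
  (forall i, is_primitive a b (F i) (f i)) ->
  is_primitive a b (fun t => \sum_(i < n) F i t) (fun t => \sum_(i < n) f i t).
Proof.
move=> prF; rewrite -!fct_sumE.
elim/big_ind2 : _ => [|F1 f1 F2 f2 pr1 pr2|i _]; last exact: prF.
- exact: is_primitive_cst.
- exact: is_primitiveD pr1 pr2.
Qed.

Lemma is_primitive_continuous a b F f : a <= b -> is_primitive a b F f ->
  {within `[a, b], continuous F}.
Proof.
move=> ab [intf FE].
have cint := parameterized_integral_continuous ab intf.
have cF : {within `[a, b], continuous (fun t => F a + \int[mu]_(w in `[a, t]) f w)}.
  by move=> t; apply: cvgD; [exact: cvg_cst|exact: cint].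
apply: subspace_eq_continuous cF => t; rewrite inE/= in_itv/= => abt.
exact/esym/FE.
Qed.

Lemma MVT_ball phi phi' c e x y : (forall z : R, is_derive z 1 phi (phi' z)) ->
  `|x - c| < e -> `|y - c| < e ->
  exists2 z, `|z - c| < e & phi y - phi x = phi' z * (y - x).
Proof.
move=> dphi; wlog xy : x y / x <= y => [mvt xc yc|].
  have [|/ltW yx] := leP x y; first by move/mvt; apply.
  have [z zc phiE] := mvt y x yx yc xc.
  by exists z; rewrite // -opprB phiE -mulrN opprB.
have cphi : continuous phi.
  by move=> z; apply: differentiable_continuous; apply/derivable1_diffP.
have [z] := MVT_segment xy (fun z _ => dphi z) (continuous_subspaceT cphi).
rewrite in_itv/= => /andP[xz zy] phiE; rewrite !ltr_norml => /andP[? _] /andP[_ ?].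
by exists z => //; rewrite ltr_norml; apply/andP; split; lra.
Qed.

End Primitives.

Section PrimitiveCalculus.
Context {R : realType}.
Local Notation mu := (@lebesgue_measure R).
Implicit Types (F G f g phi : R -> R) (a b s t : R).

Lemma within_continuous_dist_lt a b F c e : {within `[a, b], continuous F} ->
  a <= c <= b -> 0 < e ->
  exists2 d, 0 < d & forall w, a <= w <= b -> `|w - c| < d -> `|F w - F c| < e.
Proof.
move=> /subspace_continuousP/(_ c) + acb e0; rewrite /= in_itv/= => /(_ acb) Fc.
have [d /= d0 Fd] := @cvgr_dist_lt _ _ _ _ _ _ _ Fc e e0.
exists d => // w abw wc; rewrite distrC; apply: Fd; rewrite /= ?in_itv//.
by rewrite distrC.
Qed.

Lemma chain_rule_increment_le F f phi phi' c r e s t :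
  is_primitive s t F f -> (forall z : R, is_derive z 1 phi (phi' z)) ->
  mu.-integrable `[s, t] (EFin \o (fun w => phi' (F w) * f w)) ->
  s <= t ->
  (forall w, s <= w <= t -> `|F w - c| < r) ->
  (forall z1 z2, `|z1 - c| < r -> `|z2 - c| < r -> `|phi' z1 - phi' z2| <= e) ->
  `|phi (F t) - phi (F s) - \int[mu]_(w in `[s, t]) (phi' (F w) * f w)|
    <= e * \int[mu]_(w in `[s, t]) `|f w|.
Proof.
move=> prF dphi intphi st Fc osc; have intf := prF.1.
have [||z zc ->] := @MVT_ball _ phi phi' c r (F s) (F t) dphi.
  by apply: Fc; rewrite lexx.
  by apply: Fc; rewrite lexx andbT.
have intzf : mu.-integrable `[s, t] (EFin \o (fun w => phi' z * f w)).
  exact: integrable_EFinZ.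
have intabsf := integrable_norm intf.
rewrite (is_primitive_increment prF)// -RintegralZl// -RintegralB//.
have intdiff : mu.-integrable `[s, t]
    (EFin \o (fun w => phi' z * f w - phi' (F w) * f w)).
  exact: (integrableB _ intzf intphi).
apply: le_trans (le_normr_Rintegral _ intdiff) _ => //.
rewrite -RintegralZl//; apply: le_Rintegral => //.
- exact: integrable_norm intdiff.
- exact: integrable_EFinZ.
- move=> w; rewrite /= in_itv/= => stw.
  by rewrite -mulrBl normrM ler_wpM2r// osc// Fc.
Qed.

Lemma is_primitive_comp a b F f phi phi' : a <= b ->
  (forall z : R, is_derive z 1 phi (phi' z)) -> continuous phi' ->
  is_primitive a b F f ->
  is_primitive a b (fun t => phi (F t)) (fun t => phi' (F t) * f t).
Proof.
move=> ab dphi cphi' prF; have cF := is_primitive_continuous ab prF.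
have intphi : mu.-integrable `[a, b] (EFin \o (fun w => phi' (F w) * f w)).
  apply: integrable_continuousM prF.1.
  by move=> w; apply: continuous_comp; [exact: cF|exact: cphi'].
split=> // x /andP[ax xb].
pose I t := \int[mu]_(w in `[a, t]) (phi' (F w) * f w).
suff: phi (F x) - I x = phi (F a) - I a.
  by rewrite {2}/I set_itv1 Rintegral_set1 subr0 => <-; rewrite subrK.
pose M t := \int[mu]_(w in `[a, t]) `|f w|.
have prI := is_primitive_Rintegral intphi.
have prM := is_primitive_Rintegral (integrable_norm prF.1).
apply: (@locally_negligible_increment_eq _ (fun t => phi (F t) - I t) M) => //.
move=> c e /andP[ac cx] e0; have acb : a <= c <= b by rewrite ac (le_trans cx).
have e20 : 0 < e / 2 by rewrite divr_gt0.
have [r /= r0 osc] := @cvgr_dist_lt _ _ _ _ _ _ _ (cphi' (F c)) _ e20.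
have [d d0 Fd] := within_continuous_dist_lt cF acb r0.
exists d => // s t /andP[le_as sc] /andP[ct tx] cs tc.
have st := le_trans sc ct; have tb := le_trans tx xb.
have prFst := is_primitive_subitv le_as tb prF.
rewrite (is_primitive_increment prM le_as st tb).
have -> : phi (F t) - I t - (phi (F s) - I s) =
    phi (F t) - phi (F s) - (I t - I s) by ring.
rewrite (is_primitive_increment prI le_as st tb).
apply: (@chain_rule_increment_le _ _ _ _ (F c) r) => //.
- exact: integrable_sub_itv le_as tb intphi.
- move=> w /andP[sw wt]; apply: Fd.
    by rewrite (le_trans le_as sw) (le_trans wt tb).
  by rewrite ltr_norml; apply/andP; split; lra.
- move=> z1 z2 z1c z2c; rewrite -(subrKA (phi' (F c))) (le_trans (ler_normD _ _))//.
  rewrite [e]splitr lerD// ltW// ?osc//= 1?distrC// osc//= distrC//.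
Qed.

Lemma is_primitiveM a b F G f g : a <= b ->
  is_primitive a b F f -> is_primitive a b G g ->
  is_primitive a b (fun t => F t * G t) (fun t => f t * G t + F t * g t).
Proof.
(* Polarization: F G = ((F + G)^2 - (F - G)^2) / 4. *)
move=> ab prF prG.
have sqr H h : is_primitive a b H h ->
    is_primitive a b (fun t => H t ^+ 2) (fun t => 2 * H t * h t).
  apply: (@is_primitive_comp _ _ _ _ (fun z => z ^+ 2) (fun z => 2 * z)) => //.
  - by move=> z; apply: is_derive_eq; rewrite /GRing.scale/= mulr1 mulr_natl.
  - by move=> z; apply: cvgM; [exact: cvg_cst|exact: cvg_id].
have [] := is_primitiveZ 4^-1 (is_primitiveD (sqr _ _ (is_primitiveD prF prG))
  (is_primitiveZ (-1) (sqr _ _ (is_primitiveD prF (is_primitiveZ (-1) prG))))).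
set h := (fun t => 4^-1 * _); have -> : h = fun t => f t * G t + F t * g t.
  by apply/funext => t; rewrite /h; field.
move=> inth FGE; split=> // t /FGE; lra.
Qed.

Lemma is_primitive_Rintegral_rev a b f : mu.-integrable `[a, b] (EFin \o f) ->
  is_primitive a b (fun t => \int[mu]_(w in `[t, b]) f w) (fun t => - f t).
Proof.
move=> intf; split=> [|t /andP[le_at tb]].
  by apply: integrableN intf.
rewrite (Rintegral_itv_split le_at tb intf).
under [X in _ = _ + X]eq_Rintegral do rewrite -mulN1r.
rewrite RintegralZl//; last exact: integrable_sub_itv (lexx a) tb intf.
by rewrite mulN1r addrAC subrr add0r.
Qed.

Lemma is_primitive_expR_Rintegral_rev a b f : a <= b ->
  mu.-integrable `[a, b] (EFin \o f) ->
  is_primitive a b (fun t => expR (\int[mu]_(w in `[t, b]) f w))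
    (fun t => expR (\int[mu]_(w in `[t, b]) f w) * - f t).
Proof.
move=> ab /is_primitive_Rintegral_rev.
exact: (is_primitive_comp ab (@is_derive_expR R) (@continuous_expR R)).
Qed.

Lemma gronwall a b u v alpha beta : a <= b -> is_primitive a b u v ->
  mu.-integrable `[a, b] (EFin \o alpha) ->
  mu.-integrable `[a, b] (EFin \o beta) ->
  {ae mu, forall t, `[a, b]%classic t -> v t <= alpha t * u t + beta t} ->
  u b <= expR (\int[mu]_(w in `[a, b]) alpha w) * u a +
    \int[mu]_(s in `[a, b]) (expR (\int[mu]_(w in `[s, b]) alpha w) * beta s).
Proof.
move=> ab pru intalpha intbeta vle.
pose A t := \int[mu]_(w in `[t, b]) alpha w.
pose E t := expR (A t).
have prE : is_primitive a b E (fun t => E t * - alpha t).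
  exact: is_primitive_expR_Rintegral_rev.
have prEu := is_primitiveM ab prE pru.
have intEbeta : mu.-integrable `[a, b] (EFin \o (fun t => E t * beta t)).
  by apply: integrable_continuousM => //; exact: is_primitive_continuous prE.
have := prEu.2 b; rewrite ab lexx => /(_ isT).
rewrite {1}/E /A set_itv1 Rintegral_set1 expR0 mul1r => ->; rewrite lerD2l.
apply: ae_le_Rintegral => //; first exact: prEu.1.
apply: filterS vle => t {}vle /vle.
rewrite -(ler_pM2l (expR_gt0 (A t))) -/(E t); lra.
Qed.

End PrimitiveCalculus.

Lemma ae_forall_countable d (T : measurableType d) (R : realType)
    (mu : {measure set T -> \bar R}) (I : countType) (P : I -> T -> Prop) :
  (forall i, {ae mu, forall x, P i x}) -> {ae mu, forall x, forall i, P i x}.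
Proof.
move=> aeP; pose Q n x := if unpickle n is Some i then P i x else True.
have : {ae mu, forall x, forall n, Q n x}.
  apply: ae_foralln => n; rewrite /Q; case: unpickle => [i|]; first exact: aeP.
  exact: aeW.
apply: filterS => x Qx i.
by have := Qx (pickle i); rewrite /Q pickleK.
Qed.

Section BoxCovers.
Context {R : realType}.
Local Notation mu := (@lebesgue_measure R).
Implicit Types (c A B : nat -> R) (S : set R).

Lemma lebesgue_measure_segment (a b : R) :
  mu `[a, b]%classic = (Num.max 0 (b - a))%:E.
Proof.
rewrite lebesgue_measure_itv /= lte_fin.
have [ab|ba] := ltP a b; first by rewrite max_r ?EFinB// subr_ge0 ltW.
by rewrite max_l// subr_le0.
Qed.

Lemma negligible_le_eps S :
  (forall e, 0 < e -> exists2 S', S `<=` S' & (mu S' <= e%:E)%E) ->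
  mu.-negligible S.
Proof.
move=> small; apply/negligible_outer_measure/eqP.
rewrite eq_le outer_measure_ge0 andbT.
apply/lee_addgt0Pr => e /small[S' SS' muS']; rewrite add0e.
by apply: le_trans muS'; exact: le_outer_measure.
Qed.

Definition segment_series c A B (t : R) : \bar R :=
  (\sum_(k <oo) (c k * \1_(`[A k, B k]%classic) t)%:E)%E.

Lemma measurable_segment_series c A B S : (forall k, 0 <= c k) ->
  measurable_fun S (segment_series c A B).
Proof.
move=> c0; apply: (@ge0_emeasurable_sum _ _ _ _ _ xpredT) => [k t _ _|k _].
  by rewrite lee_fin mulr_ge0// indicE.
by apply/measurable_EFinP/measurable_funM.
Qed.

Lemma integral_segment_series_le c A B S : measurable S -> (forall k, 0 <= c k) ->
  (\int[mu]_(t in S) segment_series c A B t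
   <= \sum_(k <oo) (c k * Num.max 0 (B k - A k))%:E)%E.
Proof.
move=> mS c0.
rewrite integral_nneseries//; last 2 first.
- by move=> k; apply/measurable_EFinP/measurable_funM.
- by move=> k t _; rewrite lee_fin mulr_ge0// indicE.
apply: lee_nneseries => [k _ _|k _].
  by apply: integral_ge0 => t _; rewrite lee_fin mulr_ge0// indicE.
under eq_integral do rewrite EFinM.
rewrite ge0_integralZl ?lee_fin//; last exact/measurable_EFinP.
rewrite integral_indic// EFinM lee_wpmul2l ?lee_fin//.
rewrite -lebesgue_measure_segment le_measure ?inE//; exact: measurableI.
Qed.

Definition in_box n (a b p : nat -> R) := forall i, (i < n)%N -> a i <= p i <= b i.
Definition box_volume n (a b : nat -> R) := \prod_(i < n) Num.max 0 (b i - a i).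

Lemma box_volume_ge0 n (a b : nat -> R) : 0 <= box_volume n a b.
Proof. by apply: prodr_ge0 => i _; rewrite le_max lexx. Qed.

Lemma box_volumeS n (a b : nat -> R) :
  box_volume n.+1 a b = box_volume n a b * Num.max 0 (b n - a n).
Proof. by rewrite /box_volume big_ord_recr. Qed.

Definition box_cover n (a b : nat -> R) (A B : nat -> nat -> R) (D : set nat) :=
  forall p, in_box n a b p -> exists2 k, D k & in_box n (A k) (B k) p.

Lemma box_cover_slice n a b (A B : nat -> nat -> R) D t :
  box_cover n.+1 a b A B D -> a n <= t <= b n ->
  box_cover n a b A B [set k | D k /\ A k n <= t <= B k n].
Proof.
move=> cover abt p abp.
have [i|k Dk kp] := cover (fun i => if i == n then t else p i).
  by rewrite ltnS leq_eqVlt; case: eqVneq => [->//|/= _]; exact: abp.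
exists k; first by split=> //; have := kp n; rewrite eqxx; apply.
by move=> i iltn; have := kp i; rewrite ltn_eqF//; apply; exact: ltnW.
Qed.

(* Slicing along the last coordinate reduces the dimension. *)
Lemma box_volume_le_cover n (a b : nat -> R) (A B : nat -> nat -> R) (D : set nat) :
  box_cover n a b A B D ->
  ((box_volume n a b)%:E <= \sum_(k <oo) (\1_D k * box_volume n (A k) (B k))%:E)%E.
Proof.
elim: n D => [|n IHn] D cover.
  have [//|k Dk _] := cover a.
  rewrite (@nneseriesD1 _ _ k)//; last first.
    by move=> j _; rewrite lee_fin mulr_ge0 ?box_volume_ge0.
  rewrite indicE mem_set// mul1r /box_volume !big_ord0 leeDl//.
  by apply: nneseries_ge0 => j _ _; rewrite lee_fin mulr_ge0 ?big_ord0.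
pose c k : R := \1_D k * box_volume n (A k) (B k).
have c0 k : 0 <= c k by rewrite mulr_ge0 ?box_volume_ge0.
pose slices := segment_series c (fun k => A k n) (fun k => B k n).
apply: (@le_trans _ _ (\int[mu]_(t in `[a n, b n]) slices t)%E); last first.
  apply: le_trans (integral_segment_series_le _ _ _ _) _ => //.
  apply: lee_nneseries => [k _ _|k _].
    by rewrite lee_fin mulr_ge0// le_max lexx.
  by rewrite /c box_volumeS mulrA.
rewrite box_volumeS EFinM -lebesgue_measure_segment -integral_cst//.
apply: ge0_le_integral => //.
- by move=> t _; rewrite lee_fin box_volume_ge0.
- exact: measurable_segment_series.
move=> t; rewrite /= in_itv/= => abt.
apply: le_trans (IHn _ (box_cover_slice cover abt)) _.
apply: lee_nneseries => [k _ _|k _].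
  by rewrite lee_fin mulr_ge0 ?box_volume_ge0.
rewrite lee_fin /c mulrAC ler_wpM2r ?box_volume_ge0// !indicE -natrM mulnb ler_nat.
case: (boolP (k \in _)) => //; rewrite inE => -[Dk kt].
by rewrite mem_set// mem_set//= in_itv.
Qed.

End BoxCovers.

Section NullSlices.
Context {R : realType} {N : nat}.
Local Notation mu := (@lebesgue_measure R).
Local Notation vec := 'rV[R]_N.

Definition row_of_seq (p : nat -> R) : vec := \row_(i < N) p i.
Definition seq_of_row (v : vec) (i : nat) : R := oapp (v ord0) 0 (insub i).

Lemma seq_of_rowE (v : vec) (i : 'I_N) : seq_of_row v i = v ord0 i.
Proof. by rewrite /seq_of_row valK. Qed.

Lemma boxvolE (a b : R * vec) : boxvol a b =
  box_volume N (seq_of_row a.2) (seq_of_row b.2) * Num.max 0 (b.1 - a.1).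
Proof.
rewrite /boxvol mulrC; congr (_ * _); apply: eq_bigr => i _.
by rewrite !seq_of_rowE.
Qed.

(* Chebyshev's inequality for the function whose value at t is the total
   volume of the time-t slices of the covering boxes. *)
Lemma slices_containing_box_small (E : set (R * vec)) (A B : nat -> R * vec)
    (a b : nat -> R) e :
  E `<=` \bigcup_k box (A k) (B k) ->
  (forall n, \sum_(k < n) boxvol (A k) (B k) <= e * box_volume N a b) ->
  0 < box_volume N a b ->
  exists2 S : set R,
    [set t | forall p, in_box N a b p -> E (t, row_of_seq p)] `<=` S &
    (mu S <= e%:E)%E.
Proof.
move=> cover total vol0; set vol := box_volume N a b in total vol0 *.
pose c k := box_volume N (seq_of_row (A k).2) (seq_of_row (B k).2).
have c0 k : 0 <= c k by exact: box_volume_ge0.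
pose slices := segment_series c (fun k => (A k).1) (fun k => (B k).1).
have mslices D : measurable_fun D slices by exact: measurable_segment_series.
pose S := [set t | (vol%:E <= slices t)%E].
have mS : measurable S by rewrite -[S]setTI; apply: emeasurable_fun_c_infty.
exists S.
  move=> t Et; rewrite /S/=.
  pose D := [set k | (A k).1 <= t <= (B k).1].
  apply: le_trans (@box_volume_le_cover _ N a b (fun k => seq_of_row (A k).2)
     (fun k => seq_of_row (B k).2) D _) _ => [p /Et /cover[k _ [/= tk pk]]|].
    by exists k => // i iN; have := pk (Ordinal iN); rewrite mxE -!seq_of_rowE.
  apply: lee_nneseries => [k _ _|k _].
    by rewrite lee_fin mulr_ge0 ?box_volume_ge0.
  by rewrite lee_fin mulrC ler_wpM2l ?box_volume_ge0.
rewrite -(@lee_pmul2r _ vol%:E)// -EFinM muleC -integral_cst//.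
apply: (@le_trans _ _ (\int[mu]_(t in S) slices t)%E).
  apply: ge0_le_integral => //; last exact: mslices.
  by move=> t _; rewrite lee_fin ltW.
apply: le_trans (integral_segment_series_le _ _ mS c0) _.
apply: lime_le; last apply: nearW => n.
  by apply: is_cvg_nneseries => k _ _; rewrite lee_fin mulr_ge0// le_max lexx.
by rewrite big_mkord sumEFin lee_fin; under eq_bigr do rewrite -boxvolE.
Qed.

Lemma null_set_slice_misses_box (E : set (R * vec)) (a b : nat -> R) :
  Defs.null_set E -> 0 < box_volume N a b ->
  {ae mu, forall t, exists2 p, in_box N a b p & ~ E (t, row_of_seq p)}.
Proof.
move=> nullE vol0; apply: (@negligibleS _ _ _ mu
    [set t | forall p, in_box N a b p -> E (t, row_of_seq p)]).
  move=> t /= nex p abp; apply: contrapT => nEp; apply: nex.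
  by exists p.
apply: negligible_le_eps => e e0.
have [A [B [cover total]]] := nullE (e * box_volume N a b) (mulr_gt0 e0 vol0).
exact: slices_containing_box_small total vol0.
Qed.

Lemma null_set_slice_dense (E : set (R * vec)) : Defs.null_set E ->
  {ae mu, forall t, dense [set y | ~ E (t, y)]}.
Proof.
move=> nullE.
pose lo (c : seq rat * nat) i : R := ratr (nth 0 c.1 i).
pose hi c i : R := lo c i + c.2.+1%:R^-1.
have := @ae_forall_countable _ _ _ mu _
  (fun c t => exists2 p, in_box N (lo c) (hi c) p & ~ E (t, row_of_seq p)).
have vol0 c : 0 < box_volume N (lo c) (hi c).
  apply: prodr_gt0 => i _.
  by rewrite lt_max addrAC subrr add0r invr_gt0 ltr0n orbT.
move=> /(_ (fun c => null_set_slice_misses_box nullE (vol0 c))).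
apply: filterS => t miss O [x Ox] openO.
have /nbhs_ballP[e /= e0 ballO] := open_nbhs_nbhs (conj openO Ox).
have [k ke] : exists k : nat, k.+1%:R^-1 < e / 2.
  exists (Num.truncn (e / 2)^-1).
  by rewrite -[ltRHS]invrK ltf_pV2 ?posrE ?invr_gt0 ?divr_gt0// truncnS_gt.
have /choice[q qx] : forall i : nat, exists q : rat,
    seq_of_row x i - e / 2 < ratr q < seq_of_row x i.
  move=> i; have [|q] := @rat_in_itvoo R (seq_of_row x i - e / 2) (seq_of_row x i).
    by rewrite ltrBlDr ltrDl divr_gt0.
  by rewrite in_itv/= => ?; exists q.
have [p pbox nEp] := miss (mkseq q N, k).
exists (row_of_seq p); split=> //; apply: ballO; split=> // i j.
rewrite ord1 mxE -seq_of_rowE /ball/= ltr_norml.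
have := pbox j (ltn_ord j); rewrite /hi /lo /= nth_mkseq//.
set side := _^-1 in ke *; have /andP[? ?] := qx j; move=> /andP[? ?].
by apply/andP; split; lra.
Qed.

End NullSlices.

Section EuclideanNorm.
Context {R : realType} {N : nat}.
Local Notation vec := 'rV[R]_N.
Implicit Types x y : vec.

Lemma dotv_ge0 x : 0 <= dotv x x.
Proof. by apply: sumr_ge0 => i _; rewrite -expr2 sqr_ge0. Qed.

Lemma sqr_enorm x : enorm x ^+ 2 = dotv x x.
Proof. by rewrite sqr_sqrtr ?dotv_ge0. Qed.

Lemma mx_norm_le_enorm x : `|x| <= enorm x.
Proof.
rewrite [leLHS]/Num.norm /= mx_normrE; apply/bigmax_leP; split=> [|[i j] _ /=].
  exact: sqrtr_ge0.
rewrite ord1 -sqrtr_sqr ler_sqrt ?dotv_ge0// /dotv (bigD1 j)//= expr2 lerDl.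
by apply: sumr_ge0 => k _; rewrite -expr2 sqr_ge0.
Qed.

Lemma cvg_dotv (T : Type) (F : set_system T) {FF : Filter F} (u v : T -> vec) x y :
  u @ F --> x -> v @ F --> y ->
  (fun t => dotv (u t) (v t)) @ F --> dotv x y.
Proof.
move=> ux vy; apply: cvg_big => [|i _]; first exact: add_continuous.
apply: cvgM; first exact: cvg_comp ux (@coord_continuous _ _ _ _ _ x).
exact: cvg_comp vy (@coord_continuous _ _ _ _ _ y).
Qed.

Lemma continuous_enorm : continuous (@enorm R N).
Proof.
move=> x; apply: (@cvg_comp _ _ _ (fun y => dotv y y) Num.sqrt _ (nbhs (dotv x x))).
  exact: (@cvg_dotv _ (nbhs x)).
exact: sqrt_continuous.
Qed.

End EuclideanNorm.

Section Dissipativity.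
Context {R : realType} {N : nat}.
Local Notation mu := (@lebesgue_measure R).
Local Notation vec := 'rV[R]_N.
Implicit Types (f : R -> vec -> vec) (g : vec -> vec) (x y : vec).

Lemma enorm_lipschitz_cvg g (U : set vec) x l : nbhs x U ->
  (forall y, U y -> enorm (g y - g x) <= l * enorm (y - x)) ->
  g @ x --> g x.
Proof.
move=> xU lip.
have cvg_sub : y - x @[y --> x] --> x - x.
  exact: cvgB cvg_id (cvg_cst x).
have cvg_enorm : enorm (y - x) @[y --> x] --> enorm (x - x).
  exact: cvg_comp cvg_sub (@continuous_enorm _ _ _).
have cvg_bound : l * enorm (y - x) @[y --> x] --> (0 : R).
  have -> : (0 : R) = l * enorm (x - x).
    by rewrite subrr /enorm /dotv big1 ?sqrtr0 ?mulr0// => i _; rewrite mxE mul0r.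
  exact: cvgM (cvg_cst l) cvg_enorm.
apply/(@cvgrPdist_le _ _ _ (nbhs x)) => e e0; near=> y; rewrite distrC.
apply: le_trans (mx_norm_le_enorm _) _.
apply: (@le_trans _ _ (l * enorm (y - x))); first by apply: lip; near: y.
by near: y; exact: (cvgr_le _ cvg_bound _ e0).
Unshelve. all: by end_near. Qed.

Lemma compact_norm_le (r : R) : compact [set x : vec | `|x| <= r].
Proof.
apply: bounded_closed_compact.
  by exists r; split=> [|M rM x xr]; [exact: num_real|exact: le_trans xr (ltW rM)].
apply: (@preimage_closed _ _ (fun x : vec => `|x|) [set s | s <= r]).
  by move=> x _; exact: norm_continuous.
exact: closed_le.
Qed.

Lemma LC_continuous f : LC f -> {ae mu, forall t, continuous (f t)}.
Proof.
move=> [_ lc]; pose K (n : nat) := [set x : vec | `|x| <= n.+1%:R].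
have lip n : {ae mu, forall t, exists l, forall x y, K n x -> K n y ->
    enorm (f t x - f t y) <= l * enorm (x - y)}.
  have [m [l [_ [_ lipK]]]] := lc _ (@compact_norm_le n.+1%:R).
  apply: filterS lipK => t lipt.
  by exists (l t) => x y Kx Ky; exact: (lipt x y Kx Ky).2.
apply: filterS (ae_foralln lip) => t {}lip x.
pose n := Num.truncn `|x|; have [l lipn] := lip n.
have xK : nbhs x (K n).
  by apply: (cvgr_norm_le _ (@cvg_id _ (nbhs x))); rewrite truncnS_gt.
apply: (enorm_lipschitz_cvg xK) => y Ky; apply: lipn => //.
exact: nbhs_singleton.
Qed.

Lemma dense_sub_closed (T : topologicalType) (D C : set T) :
  dense D -> closed C -> D `<=` C -> C = setT.
Proof.
move=> denseD closedC DC; apply/seteqP; split=> // x _; apply: contrapT => nCx.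
have [|y [nCy /DC]//] := denseD (~` C) _ (closed_openC closedC).
by exists x.
Qed.

Lemma H1_ae f alpha beta : LC f -> H1 f alpha beta ->
  {ae mu, forall t, forall x : vec,
    2 * dotv (f t x) x <= alpha t * enorm x ^+ 2 + beta t}.
Proof.
move=> lcf [_ [_ [_ [E [nullE dissip]]]]].
apply: filterS2 (LC_continuous lcf) (null_set_slice_dense nullE) => t cft denseE.
pose defect x := 2 * dotv (f t x) x - alpha t * dotv x x.
have cdefect : continuous defect.
  move=> x; have cvgx : id @ nbhs x --> x by exact: cvg_id.
  apply: (@cvgB _ _ _ (nbhs x)).
    by apply: (@cvgM _ _ (nbhs x)); [exact: cvg_cst|exact: (cvg_dotv (cft x) cvgx)].
  by apply: (@cvgM _ _ (nbhs x)); [exact: cvg_cst|exact: (cvg_dotv cvgx cvgx)].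
have closed_le_beta : closed (defect @^-1` [set r | r <= beta t]).
  by apply: preimage_closed => [x _|]; [exact: cdefect|exact: closed_le].
have defect_le x : (defect x <= beta t) =
    (2 * dotv (f t x) x <= alpha t * enorm x ^+ 2 + beta t).
  by rewrite lerBlDl sqr_enorm.
have full : defect @^-1` [set r | r <= beta t] = setT.
  by apply: (dense_sub_closed denseE) => // y /dissip; rewrite /= defect_le.
by move=> x; rewrite -defect_le; have : setT x by []; rewrite -full.
Qed.

End Dissipativity.

Section Solutions.
Context {R : realType} {N : nat}.
Local Notation mu := (@lebesgue_measure R).
Local Notation vec := 'rV[R]_N.
Variables (f : R -> vec -> vec) (r : R) (x0 : vec) (x : R -> vec).
Hypothesis solx : is_solution f r x0 x.

Lemma solution_sqr_enorm_primitive (t : R) : r <= t ->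
  is_primitive r t (fun s => enorm (x s) ^+ 2)
    (fun s => 2 * dotv (f s (x s)) (x s)).
Proof.
move=> rt.
have prx i : is_primitive r t (fun s => x s ord0 i) (fun s => f s (x s) ord0 i).
  split=> [|s /andP[rs _]]; first exact: (solx.2 t rt i).1.
  by rewrite (solx.2 s rs i).2 solx.1.
have := is_primitive_sum (fun i => is_primitiveM rt (prx i) (prx i)).
under eq_fun do rewrite -/(dotv _ _) -sqr_enorm.
congr (is_primitive _ _ _ _); apply/funext => s.
rewrite /dotv mulr_sumr; apply: eq_bigr => i _.
by rewrite [x s ord0 i * _]mulrC mulr2n mulrDl mul1r.
Qed.

Lemma solution_gronwall (alpha beta : R -> R) (t : R) :
  LC f -> H1 f alpha beta -> r <= t ->
  enorm (x t) ^+ 2 <= expR (\int[mu]_(w in `[r, t]) alpha w) * enorm x0 ^+ 2 +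
    \int[mu]_(s in `[r, t]) (expR (\int[mu]_(w in `[s, t]) alpha w) * beta s).
Proof.
move=> lcf h1f rt; have [intalpha [intbeta _]] := h1f.
rewrite -[in leRHS]solx.1.
apply: (gronwall rt (solution_sqr_enorm_primitive rt)) => //.
by apply: filterS (H1_ae lcf h1f).
Qed.

End Solutions.

Section ExponentialDecay.
Context {R : realType}.
Local Notation mu := (@lebesgue_measure R).
Implicit Types (alpha beta g : R -> R) (tau k K C : R).

(* Uniform exponential stability on [tau, oo) of the scalar equation u' = alpha u. *)
Definition exp_decay_from tau alpha k K := forall s t, tau <= s -> s <= t ->
  expR (\int[mu]_(w in `[s, t]) alpha w) <= K * expR (- k * (t - s)).

Lemma exp_decay_from_ge1 alpha tau k K : exp_decay_from tau alpha k K -> 1 <= K.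
Proof.
move=> /(_ tau tau (lexx _) (lexx _)).
by rewrite set_itv1 Rintegral_set1 expR0 subrr mulr0 expR0 mulr1.
Qed.

Lemma exp_decay_from_extend alpha k K sigma tau : locint alpha ->
  exp_decay_from sigma alpha k K -> exists K', exp_decay_from tau alpha k K'.
Proof.
move=> intalpha decay; have K1 := exp_decay_from_ge1 decay.
pose L s t := \int[mu]_(w in `[s, t]) alpha w + k * (t - s).
have expLE K' s t : (expR (\int[mu]_(w in `[s, t]) alpha w)
    <= K' * expR (- k * (t - s))) = (expR (L s t) <= K').
  by rewrite mulNr expRN ler_pdivlMr ?expR_gt0// -expRD.
pose P := \int[mu]_(w in `[tau, sigma]) `|alpha w| + `|k| * `|sigma - tau|.
have P0 : 0 <= P by rewrite addr_ge0// Rintegral_ge0.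
have LP s t : tau <= s -> s <= t -> t <= sigma -> L s t <= P.
  move=> taus st tsigma; apply: lerD.
    rewrite (le_trans (ler_norm _))//.
    rewrite (le_trans (le_normr_Rintegral _ (intalpha s t)))//.
    by apply: ge0_le_Rintegral_itv => //; exact: integrable_norm (intalpha _ _).
  rewrite (le_trans (ler_norm _))// normrM ler_wpM2l//.
  rewrite ger0_norm ?subr_ge0// (le_trans _ (ler_norm _))//; lra.
exists (expR P * K) => s t taus st; rewrite expLE.
have [sigmas|/ltW ssigma] := leP sigma s.
  apply: (@le_trans _ _ K); first by rewrite -expLE decay.
  by rewrite ler_peMl ?(le_trans ler01)// -expR0 ler_expR.
have [tsigma|/ltW sigmat] := leP t sigma.
  apply: (@le_trans _ _ (expR P)); first by rewrite ler_expR LP.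
  by rewrite ler_peMr ?expR_ge0.
have -> : L s t = L s sigma + L sigma t.
  by rewrite /L (Rintegral_itv_split ssigma sigmat (intalpha s t)); ring.
rewrite expRD ler_pM ?expR_ge0 ?ler_expR ?LP//.
by rewrite -expLE decay.
Qed.

Lemma H3_unit_window beta :
  locint beta -> (forall t, 0 <= beta t) -> H3 beta ->
  exists2 C, 0 <= C & forall t, \int[mu]_(w in `[t, t + 1]) beta w <= C.
Proof.
move=> intbeta beta0 h3; have [C leC] := h3 (1 / 2) (divr_gt0 ltr01 (ltr0n _ 2)).
suff unit_window t : \int[mu]_(w in `[t, t + 1]) beta w <= C.
  by exists C => //; apply: le_trans (unit_window 0); exact: Rintegral_ge0.
rewrite -(@ge0_Rintegral_translate _ _ _ _ (t + 1 / 2))//.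
have -> : t - (t + 1 / 2) = - (1 / 2) by ring.
by have -> : t + 1 - (t + 1 / 2) = 1 / 2 by field.
Qed.

Definition exp_convolution k g a t :=
  \int[mu]_(s in `[a, t]) (expR (- k * (t - s)) * g s).

Lemma integrable_exp_kernelM g k c a b : mu.-integrable `[a, b] (EFin \o g) ->
  mu.-integrable `[a, b] (EFin \o (fun s => expR (- k * (c - s)) * g s)).
Proof.
move=> intg; apply: integrable_continuousM intg; apply: continuous_subspaceT => s.
apply: continuous_comp; last exact: continuous_expR.
by apply: cvgM; [exact: cvg_cst|apply: cvgB; [exact: cvg_cst|exact: cvg_id]].
Qed.

Lemma exp_convolution_split g k a b t : locint g -> a <= b -> b <= t ->
  exp_convolution k g a t =
  expR (- k * (t - b)) * exp_convolution k g a b + exp_convolution k g b t.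
Proof.
move=> intg ab bt; have intk c a' b' := integrable_exp_kernelM k c (intg a' b').
rewrite /exp_convolution (Rintegral_itv_split ab bt (intk t a t)); congr (_ + _).
rewrite -RintegralZl//; apply: eq_Rintegral => s _; rewrite mulrA -expRD.
by congr (expR _ * _); ring.
Qed.

Lemma exp_convolution_le_Rintegral g k a t : 0 <= k -> locint g ->
  (forall s, 0 <= g s) -> exp_convolution k g a t <= \int[mu]_(s in `[a, t]) g s.
Proof.
move=> k0 intg g0; apply: le_Rintegral => //; first exact: integrable_exp_kernelM.
move=> s; rewrite /= in_itv/= => /andP[_ st].
by rewrite ler_piMl// -expR0 ler_expR mulNr oppr_le0 mulr_ge0 ?subr_ge0.
Qed.

(* The bound is the fixed point of M |-> expR (- k) * M + C: passing from t - 1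
   to t damps the past by expR (- k) and adds one unit window. *)
Lemma exp_convolution_le g k C a t : 0 < k -> locint g -> (forall s, 0 <= g s) ->
  0 <= C -> (forall s, \int[mu]_(w in `[s, s + 1]) g w <= C) ->
  a <= t -> exp_convolution k g a t <= C / (1 - expR (- k)).
Proof.
move=> k0 intg g0 C0 leC le_at; set M := C / (1 - expR (- k)).
have q1 : 0 < 1 - expR (- k) by rewrite subr_gt0 -expR0 ltr_expR oppr_lt0.
have ME : expR (- k) * M + C = M by rewrite /M; field; rewrite gt_eqF.
have CM : C <= M by rewrite -ME lerDr mulr_ge0 ?expR_ge0// divr_ge0 ?(ltW q1).
have window s b : s <= b -> b <= s + 1 -> exp_convolution k g s b <= C.
  move=> sb bs1; apply: le_trans (exp_convolution_le_Rintegral _ _ _ _ _) _ => //.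
    exact: ltW.
  by apply: le_trans (leC s); exact: ge0_le_Rintegral_itv.
have [n] : exists n : nat, t <= a + n.+1%:R.
  by exists (Num.truncn (t - a)); rewrite -lerBlDl ltW// truncnS_gt.
elim: n t le_at => [|n IHn] t le_at tan.
  exact: le_trans (window a t le_at tan) CM.
have [ta1|/ltW a1t] := leP t (a + 1).
  exact: le_trans (window a t le_at ta1) CM.
have at1 : a <= t - 1 by rewrite lerBrDr.
rewrite (exp_convolution_split _ intg at1) ?gerBl// subKr mulr1 -[leRHS]ME lerD//.
  by rewrite ler_wpM2l ?expR_ge0// IHn// lerBlDr -addrA natr1.
by apply: window; rewrite ?subrK ?gerBl.
Qed.

Lemma exp_decay_gronwall_le alpha beta k K tau r t u0 :
  exp_decay_from tau alpha k K -> locint alpha -> locint beta ->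
  (forall s, 0 <= beta s) -> tau <= r -> r <= t -> 0 <= u0 ->
  expR (\int[mu]_(w in `[r, t]) alpha w) * u0 +
    \int[mu]_(s in `[r, t]) (expR (\int[mu]_(w in `[s, t]) alpha w) * beta s)
  <= K * (expR (- k * (t - r)) * u0 + exp_convolution k beta r t).
Proof.
move=> decay intalpha intbeta beta0 taur rt u00.
rewrite mulrDr mulrA lerD ?ler_wpM2r ?decay//.
have intk := integrable_exp_kernelM k t (intbeta r t).
rewrite -RintegralZl//; apply: le_Rintegral => //.
- apply: integrable_continuousM (intbeta r t).
  apply: (is_primitive_continuous rt).
  exact: (is_primitive_expR_Rintegral_rev rt (intalpha r t)).
- exact: integrable_EFinZ.
- move=> s; rewrite /= in_itv/= => /andP[rs st].
  by rewrite mulrA ler_wpM2r ?decay// (le_trans taur).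
Qed.

End ExponentialDecay.

Lemma UUB_exponential_estimate (R : realType) (N : nat)
    (f : R -> 'rV[R]_N -> 'rV[R]_N) (tau k K M : R) :
  0 < k -> 0 < K -> 0 <= M ->
  (forall r t x0 x, tau <= r -> r <= t -> is_solution f r x0 x ->
    enorm (x t) ^+ 2 <= K * (expR (- k * (t - r)) * enorm x0 ^+ 2 + M)) ->
  UUB f tau.
Proof.
move=> k0 K0 M0 estimate; exists (Num.sqrt (K * (1 + M))); split.
  by rewrite sqrtr_gt0 mulr_gt0// ltr_wpDr.
move=> d d0; exists (d ^+ 2 / k); split; first by rewrite divr_gt0 ?exprn_gt0.
move=> r t x0 x taur Tt x0d solx.
have t0 : 0 <= t by apply: le_trans Tt; rewrite divr_ge0 ?sqr_ge0 ?ltW.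
rewrite -[leLHS]ger0_norm ?sqrtr_ge0// -sqrtr_sqr ler_wsqrtr//.
apply: le_trans (estimate r (t + r) x0 x taur _ solx) _; first by rewrite lerDr.
rewrite ler_pM2l// lerD2r addrK mulNr expRN mulrC ler_pdivrMr ?expR_gt0// mul1r.
apply: (@le_trans _ _ (k * t)); last by have := expR_ge1Dx (k * t); lra.
apply: (@le_trans _ _ (d ^+ 2)); first by rewrite lerXn2r ?nnegrE ?sqrtr_ge0// ltW.
by rewrite mulrC -ler_pdivrMr.
Qed.

Theorem theorem6p5 (R : realType) (N : nat) (f : R -> 'rV[R]_N -> 'rV[R]_N)
    (alpha beta : R -> R) :
  LC f -> H1 f alpha beta -> H3 beta -> H2star alpha ->
  forall tau : R, UUB f tau.
Proof.
move=> lcf h1f h3 [k [K' [k0 [_ decay0]]]] tau.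
have [intalpha [intbeta [beta0 _]]] := h1f.
have [C C0 leC] := H3_unit_window intbeta beta0 h3.
have [K decay] := exp_decay_from_extend tau intalpha decay0.
have Kgt0 : 0 < K by rewrite (lt_le_trans ltr01)// (exp_decay_from_ge1 decay).
have M0 : 0 <= C / (1 - expR (- k)).
  by rewrite divr_ge0// subr_ge0 -expR0 ler_expR oppr_le0 ltW.
apply: (UUB_exponential_estimate k0 Kgt0 M0) => r t x0 x taur rt solx.
apply: le_trans (solution_gronwall solx lcf h1f rt) _.
apply: le_trans (exp_decay_gronwall_le decay intalpha intbeta beta0 taur rt
  (sqr_ge0 _)) _.
by rewrite ler_pM2l// lerD2l exp_convolution_le.
Qed.
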